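(* Let $X$ be a Tychonoff space with weight $w(X)$, and let $\mathcal C$ be the class of Baire metrizable spaces of density $\le w(X)$. Assume that $X$ is $\mathcal C$-Piotrowski. Then $X$ contains a dense metrizable Baire subspace if and only if $X$ is Baire.
   Context: A topological space $X$ is Baire if for any sequence $(U_n)_{n\in\omega}$ of open dense subsets of $X$ the intersection $\bigcap_{n\in\omega}U_n$ is dense in $X$. A function $f:Z\to X$ between topological spaces is quasicontinuous if for every $z\in Z$, every neighborhood $O_z$ of $z$ in $Z$ and every neighborhood $O_{f(z)}$ of $f(z)$ in $X$ there is a non-empty open set $U\subset O_z$ with $f(U)\subset O_{f(z)}$. For a class $\mathcal C$ of Baire spaces, a topological space $X$ is $\mathcal C$-Piotrowski if every quasicontinuous map $f:C\to X$ defined on a non-empty space $C\in\mathcal C$ has a continuity point. The weight $w(X)$ is the smallest cardinality of a base of the topology; the density of a space is the smallest cardinality of a dense subset. *)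

(* Defs.v *)
From HB Require Import structures.
From mathcomp Require Import all_boot all_order all_algebra.
From mathcomp Require Import all_classical all_reals all_analysis.

Set Implicit Arguments.
Unset Strict Implicit.
Unset Printing Implicit Defensive.

Local Open Scope classical_set_scope.
Local Open Scope card_scope.

Definition tychonoff_space (X : topologicalType) : Prop :=
  hausdorff_space X /\ completely_regular_space X.

Definition baire_space (X : topologicalType) : Prop :=
  forall U : nat -> set X,
    (forall n, open (U n) /\ dense (U n)) -> dense (\bigcap_n U n).

Definition metrizable_space (R : realType) (X : topologicalType) : Prop :=
  exists (M : metricType R) (f : X -> M) (g : M -> X),
    [/\ cancel f g, cancel g f, continuous f & continuous g].

Definition quasicontinuous (Z X : topologicalType) (f : Z -> X) : Prop :=
  forall (z : Z) (Oz : set Z) (Ofz : set X), nbhs z Oz -> nbhs (f z) Ofz ->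
    exists U : set Z, [/\ open U, U !=set0, U `<=` Oz & f @` U `<=` Ofz].

(* [C] stands for a class of Baire spaces. *)
Definition piotrowski_space (C : topologicalType -> Prop) (X : topologicalType)
    : Prop :=
  forall Z : topologicalType, C Z -> [set: Z] !=set0 ->
  forall f : Z -> X, quasicontinuous f -> exists z : Z, {for z, continuous f}.

(* The library compares cardinals of sets but has no type of cardinals, so
   "the smallest cardinality of a set satisfying [P]" is represented by a set
   [A] satisfying [P] and having that cardinality. *)
Definition smallest_card (T : Type) (P : set T -> Prop) (A : set T) : Prop :=
  P A /\ forall B : set T, P B -> A #<= B.

Definition realizes_weight (X : topologicalType) (B : set (set X)) : Prop :=
  smallest_card (@basis X) B.

Definition realizes_density (X : topologicalType) (D : set X) : Prop :=
  smallest_card (@dense X) D.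

Definition density_le_weight (Z X : topologicalType) : Prop :=
  exists (D : set Z) (B : set (set X)),
    [/\ realizes_density D, realizes_weight B & D #<= B].

Definition baire_metrizable_density_le_weight (R : realType)
    (X Z : topologicalType) : Prop :=
  [/\ baire_space Z, metrizable_space R Z & density_le_weight Z X].

(* Main.v *)
Require Import Defs.
From HB Require Import structures.
From mathcomp Require Import all_boot all_order all_algebra.
From mathcomp Require Import all_classical all_reals all_analysis.

(** A space with a dense Baire subspace is Baire, so the content is the
    construction of a dense metrizable Baire subspace in a Baire Piotrowski
    space [X].

    Call an open set [W] tame when it carries a sequence of disjoint families
    [V n] of open sets, each with dense union in [W], such that every point
    lying in all these unions has the members containing it as a neighborhood
    base.  When the whole space is tame, the set of points lying in all the
    unions is a dense G-delta set: it is dense and Baire because [X] is Baire,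
    and it is metrizable because its topology is read off from the sequence of
    members containing a point ([tame_dense_metrizable]).  Tameness is local, since the
    families carried by pairwise disjoint tame sets can be put together
    ([tame_locally]).  It remains to find a tame nonempty open set inside every
    nonempty open set.

    Suppose that the nonempty open set [W0] contains none.  Fix a base [B] of
    smallest cardinality and consider the decreasing sequences of nonempty
    members of [B] inside [W0] which have a common point but form a neighborhood
    base at no point; call them bad.  Bad sequences, topologized by their finite
    prefixes, form a metrizable space [Z].

    - [Z] is Baire.  Given dense open conditions [D k] on finite sequences and a
      finite sequence [s], maximal disjoint families yield a tree of extensions
      of [s] that meets one more condition on each level, and whose last terms
      are disjoint on each level.  If no bad sequence through [s] met all the
      conditions, every branch with a common point would be a neighborhood base
      of that point, and the levels would make the last term of [s] tame
      ([tree_dichotomy]).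

    - [Z] has density at most the weight of [X], as an infinite set has as many
      finite sequences as elements ([card_words_le]).  If [B] is finite, then
      [X] is discrete and singletons are tame.

    - A function [f] sending each bad sequence to one of its common points is
      quasicontinuous, because a finite sequence can be continued by an
      arbitrarily small basic set.  It has no continuity point: if [f] is
      continuous at [z], the image of some cylinder around [z] lies in a small
      closed neighborhood of [f z]; that image is dense in a term of [z], so
      this term is small as well, and [z] is a neighborhood base at [f z]
      ([bad_selection]).

    This contradicts the Piotrowski property of [X]. *)

Set Implicit Arguments.
Unset Strict Implicit.
Unset Printing Implicit Defensive.

Import Order.TTheory GRing.Theory Num.Theory.

Local Open Scope classical_set_scope.
Local Open Scope card_scope.

(** * Comparison of cardinalities *)

Lemma card_le_of_inj (T U : Type) (A : set T) (B : set U) (f : T -> U) :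
  (forall x, A x -> B (f x)) ->
  (forall x y, A x -> A y -> f x = f y -> x = y) ->
  A #<= B.
Proof.
move=> fAB finj; suff /unsquash g : $|{injfun A >-> B}| by exact: inj_card_le g.
apply/injfunPex; exists f => //.
by move=> x y /set_mem Ax /set_mem Ay; apply: finj.
Qed.

Lemma inj_of_card_le (T : Type) (U : Type) (A : set T) (B : set U) (u0 : U) :
  A #<= B -> exists f : T -> U, (forall x, A x -> B (f x)) /\
    (forall x y, A x -> A y -> f x = f y -> x = y).
Proof.
move=> /card_leP[g].
pose h (x : T) : U := match pselect (A x) with
  | left Ax => \val (g (SigSub (mem_set Ax))) | right _ => u0 end.
exists h; split=> [x Ax|x y Ax Ay]; rewrite /h; case: pselect => // Ax'.
  exact: set_valP.
case: pselect => // Ay' /val_inj /inj.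
by rewrite !inE => /(_ I I) [].
Qed.

(** Consider functions [g] choosing an element of every set satisfying [P], and
    a maximal set [E] of such functions any two of which differ at every
    argument; disjointness of the graphs [L g] expresses this.  By maximality
    the values [g A] exhaust some [A], so that [A] is an image of [E], while
    evaluation at any [B] satisfying [P] embeds [E] into [B]. *)
Lemma smallest_card_exists (T : Type) (P : set T -> Prop) :
  (exists A, P A) -> exists A, smallest_card P A.
Proof.
move=> [A0 PA0].
pose Q := [set g : set T -> T | forall A, P A -> A (g A)].
pose L (g : set T -> T) := [set (A, g A) | A in P].
have [E [EQ EL Emax]] := ex_maximal_disjoint_subcollection L Q.
suff [A PA AE] : exists2 A, P A & A `<=` [set g A | g in E].
  exists A; split => // B PB; apply: (card_le_trans (subset_card_le AE)).
  apply: (card_le_trans (card_image_le _ _)).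
  apply: (@card_le_of_inj _ _ _ _ (fun g => g B)) => [g /EQ|g h Eg Eh gh];
    first exact.
  by apply: EL => //; exists (B, g B); split; exists B => //; rewrite gh.
apply: contrapT => noA.
have pickA A : P A -> exists a, A a /\ ~ [set g A | g in E] a.
  move=> PA; apply: contrapT => nA; apply: noA; exists A => // a Aa.
  by apply: contrapT => na; apply: nA; exists a.
have [t0 _] := pickA _ PA0.
have pickT A : exists a, P A -> A a /\ ~ [set g A | g in E] a.
  have [/pickA[a aP]|nPA] := pselect (P A); first by exists a.
  by exists t0.
have [g gP] := choice pickT.
have nEg : ~ E g by move=> Eg; have [_ []] := gP _ PA0; exists g.
apply: (Emax (g |` E)).
- by split; [move=> h; right | move=> /(_ g); apply: contra_not nEg; apply;
    left].
- by move=> h [->|/EQ //] A PA; have [] := gP _ PA.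
- have ndisj h : E h -> ~ (L g `&` L h !=set0).
    move=> Eh [[A a] [[A1 PA1 [<- <-]] [A2 PA2 [A21 hg]]]].
    by have [_ []] := gP _ PA1; exists h => //; rewrite -hg A21.
  move=> h h' [->|Eh] [->|Eh'] //.
  + by move=> /(ndisj _ Eh').
  + by rewrite setIC => /(ndisj _ Eh).
  + exact: EL.
Qed.

Lemma card_le_total (T : Type) (A B : set T) : A #<= B \/ B #<= A.
Proof.
have [|C [[->|->] Cmin]] := @smallest_card_exists T (fun S => S = A \/ S = B).
- by exists A; left.
- by left; apply: Cmin; right.
- by right; apply: Cmin; left.
Qed.

(** * Finite sequences over an infinite set *)

(** The empty word is left out so that the empty graph is a partial coding of
    words, from which the search for a maximal one can start. *)
Definition words (T : eqType) (A : set T) : set (seq T) :=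
  [set w | w != [::] /\ forall x, x \in w -> A x].

Lemma map_inj_on (T U : eqType) (A : set T) (k : T -> U) (v w : seq T) :
  (forall x y, A x -> A y -> k x = k y -> x = y) ->
  (forall x, x \in v -> A x) -> (forall x, x \in w -> A x) ->
  [seq k x | x <- v] = [seq k x | x <- w] -> v = w.
Proof.
move=> kinj; elim: v w => [|a v IH] [|b w] //= Av Aw [kab kvw].
congr (_ :: _).
  by apply: kinj => //; [apply: Av | apply: Aw]; rewrite mem_head.
by apply: IH => // x xs; [apply: Av | apply: Aw]; rewrite inE xs orbT.
Qed.

Section coding.
Variables (T : eqType) (f : seq T -> T).

Definition codes (S : set T) :=
  (forall w, words S w -> S (f w)) /\
  (forall v w, words S v -> words S w -> f v = f w -> v = w).

(** A coded set absorbs a second copy of itself, without cardinal arithmetic: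
    elements of [S] become words of length one, and the others, sent into [S] by
    [i], words of length two. *)
Lemma codes_extend (S U : set T) (i : T -> T) : codes S ->
  (forall x, U x -> ~ S x -> S (i x)) ->
  (forall x y, U x -> U y -> ~ S x -> ~ S y -> i x = i y -> x = y) ->
  exists k : T -> T, (forall x, U x -> S (k x)) /\
    (forall x y, U x -> U y -> k x = k y -> x = y).
Proof.
move=> [fS finj] iS iinj.
pose h x := if `[< S x >] then [:: x] else [:: i x; i x].
have hS x : U x -> words S (h x).
  move=> Ux; rewrite /h; case: asboolP => Sx; split => // y.
    by rewrite inE => /eqP ->.
  by rewrite !inE orbb => /eqP ->; apply: iS.
exists (fun x => f (h x)); split => [x /hS /fS //|x y Ux Uy].
move=> /(finj _ _ (hS _ Ux) (hS _ Uy)); rewrite /h.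
by case: asboolP => Sx; case: asboolP => Sy // [] // ixy *; exact: iinj ixy.
Qed.

Lemma codes_words (S U : set T) (k : T -> T) : codes S ->
  (forall x, U x -> S (k x)) ->
  (forall x y, U x -> U y -> k x = k y -> x = y) ->
  (forall w, words U w -> S (f [seq k x | x <- w])) /\
  (forall v w, words U v -> words U w ->
     f [seq k x | x <- v] = f [seq k x | x <- w] -> v = w).
Proof.
move=> [fS finj] kS kinj.
have kw w : words U w -> words S [seq k x | x <- w].
  move=> [w0 Uw]; split; first by case: w w0 {Uw}.
  by move=> _ /mapP[x xw ->]; apply/kS/Uw.
split=> [w /kw /fS //|v w Uv Uw /(finj _ _ (kw _ Uv) (kw _ Uw))].
by apply: map_inj_on kinj _ _; [exact: Uv.2 | exact: Uw.2].
Qed.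

End coding.

Section coding_graph.
Variables (T : choiceType) (A : set T).
Implicit Types G : set (seq T * T).

(** Partial codings are represented by their graphs, so that the upper bound
    of a chain is its union. *)
Definition field G := [set x | exists y, G ([:: x], y)].

Definition coding_graph G := [/\ field G `<=` A,
  forall w x, G (w, x) -> words (field G) w /\ field G x,
  forall w, words (field G) w -> exists x, G (w, x),
  forall w x y, G (w, x) -> G (w, y) -> x = y &
  forall v w x, G (v, x) -> G (w, x) -> v = w].

Lemma coding_graph_bigcup (F : set (set (seq T * T))) :
  F `<=` coding_graph -> total_on F subset ->
  coding_graph (\bigcup_(G in F) G).
Proof.
move=> FP Ftot.
have fieldS G : F G -> field G `<=` field (\bigcup_(G in F) G).
  by move=> FG x [y Gy]; exists y, G.
have pair G H g h : F G -> F H -> G g -> H h -> exists K, [/\ F K, K g & K h].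
  move=> FG FH Gg Hh; have [GH|HG] := Ftot _ _ FG FH; first by exists H;
    split=> //; apply: GH.
  by exists G; split => //; apply: HG.
split.
- by move=> x [y [G FG Gy]]; have [+ _ _ _ _] := FP _ FG; apply; exists y.
- move=> w x [G FG Gwx]; have [_ /(_ _ _ Gwx)[[w0 wG] xG] _ _ _] := FP _ FG.
  by split; [split => // y /wG|]; [|move: x xG {Gwx}]; exact: fieldS.
- move=> w [w0 wF].
  suff [G FG wG] : exists2 G, F G & forall x, x \in w -> field G x.
    have [_ _ /(_ w)[|x Gx _ _]] := FP _ FG; first by split.
    by exists x, G.
  elim: w w0 wF => // a [_ _ wF|b w IH _ wF].
    have [|y [G FG Gy]] := wF a; first by rewrite mem_head.
    by exists G => // x; rewrite inE => /eqP ->; exists y.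
  have [x xw|G FG wG] := IH isT; first by apply: wF; rewrite inE xw orbT.
  have [|y [H FH Hy]] := wF a; first by rewrite mem_head.
  have [GH|HG] := Ftot _ _ FG FH.
    exists H => // x; rewrite inE => /orP[/eqP ->|/wG[z /GH Hz]];
      first by exists y.
    by exists z.
  exists G => // x; rewrite inE => /orP[/eqP ->|/wG //].
  by exists y; exact: HG.
- move=> w x y [G FG Gx] [H FH Hy];
    have [K [FK Kx Ky]] := pair _ _ _ _ FG FH Gx Hy.
  by have [_ _ _ + _] := FP _ FK; apply; eassumption.
- move=> v w x [G FG Gx] [H FH Hy];
    have [K [FK Kx Ky]] := pair _ _ _ _ FG FH Gx Hy.
  by have [_ _ _ _ +] := FP _ FK; apply; eassumption.
Qed.

(** The words over the enlarged field that are not already coded all receive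
    codes in the new part [S'], which keeps them apart from the old codes. *)
Lemma coding_graph_extend G (S' : set T) (g : seq T -> T) :
  coding_graph G -> S' !=set0 -> S' `<=` A `\` field G ->
  (forall w, words (field G `|` S') w -> S' (g w)) ->
  (forall v w, words (field G `|` S') v -> words (field G `|` S') w ->
    g v = g w -> v = w) ->
  exists2 H, G `<` H & coding_graph H.
Proof.
move=> [GA Gr Gt Gf Gi] [s0 S's0] S'A gS ginj.
set U := field G `|` S' in gS ginj.
pose H := G `|` [set p | [/\ words U p.1, ~ words (field G) p.1 & p.2 = g p.1]].
have one (W : set T) a : W a -> words W [:: a].
  by move=> Wa; split => // y; rewrite inE => /eqP ->.
have new x : S' x -> ~ words (field G) [:: x].
  move=> S'x [_ /(_ x)]; rewrite mem_head => /(_ isT).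
  by have [] := S'A _ S'x.
have fH : field H = U.
  apply/seteqP; split => [x [y [Gxy|[/= [_ Ux] _ _]]]|x [[y Gxy]|S'x]].
  - by left; exists y.
  - by apply: Ux; rewrite mem_head.
  - by exists y; left.
  - exists (g [:: x]); right; split => //=; last exact: new.
    by apply: one; right.
have wGU : words (field G) `<=` words U.
  by move=> w [w0 wG]; split => // x /wG; left.
exists H.
  split; first by move=> p; left.
  move=> HG; apply: (new _ S's0); have /HG/Gr[//] : H ([:: s0], g [:: s0]).
  by right; split => //=; [apply: one; right | exact: new].
split; rewrite ?fH.
- by move=> x [/GA //|/S'A[]].
- move=> w x [/Gr[/wGU ? ?]|[/= ? _ ->]]; first by split => //; left.
  by split => //; right; exact: gS.
- move=> w Uw; have [/Gt[x Gx]|nw] := pselect (words (field G) w).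
    by exists x; left.
  by exists (g w); right.
- move=> w x y [Gx|[/= _ nw ->]] [Gy|[/= _ nw' ->]] //; first exact: Gf Gx Gy.
    by case: nw'; exact: (Gr _ _ Gx).1.
  by case: nw; exact: (Gr _ _ Gy).1.
- have abs w v x : G (w, x) -> words U v -> x = g v -> False.
    move=> /Gr[_ fx] /gS + xE; rewrite -xE => /S'A[_]; exact.
  move=> v w x [Gx|[/= Uv _ xE]] [Gy|[/= Uw _ xE']]; first exact: Gi Gx Gy.
  - by case: (abs _ _ _ Gx Uw xE').
  - by case: (abs _ _ _ Gy Uv xE).
  - by apply: ginj => //; rewrite -xE -xE'.
Qed.

End coding_graph.

(** Take a maximal partial coding, by Zorn, and let [S] be its field.  It is
    nonempty, since a countable subset of [A] can be coded.  If the rest of [A]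
    contained a copy of [S], this copy could be added to the field; hence the
    rest of [A] embeds into [S], and so do [A] and the words over [A]. *)
Lemma card_words_le (T : choiceType) (A : set T) :
  infinite_set A -> words A #<= A.
Proof.
move=> Ainf; have [a0 Aa0] := infinite_setN0 Ainf.
have [G [PG Gmax]] := Zorn_bigcup (@coding_graph_bigcup T A).
have noext S' g : S' !=set0 -> S' `<=` A `\` field G ->
    (forall w, words (field G `|` S') w -> S' (g w)) ->
    (forall v w, words (field G `|` S') v -> words (field G `|` S') w ->
      g v = g w -> v = w) -> False.
  move=> S'0 S'A gS ginj.
  by have [H /Gmax GH /GH] := coding_graph_extend PG S'0 S'A gS ginj.
have [GA Gr Gt _ Gi] := PG.
have /choice[f fP] : forall w, exists x, words (field G) w -> G (w, x).
  move=> w; have [/Gt[x Gx]|nw] := pselect (words (field G) w);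
    first by exists x.
  by exists a0.
have fcodes : codes f (field G).
  split=> [w /fP/Gr[] //|v w /fP Gv /fP Gw fvw].
  by apply: Gi Gv _; rewrite fvw.
have [G0|/set0P[s0 Gs0]] := eqVneq (field G) set0.
  (* Words over the countable set [range e] are coded through [pickle]. *)
  exfalso; have [e [eA einj]] := inj_of_card_le a0 ((infiniteP A).1 Ainf).
  have /choice[d dP] : forall x, exists n, (range e) x -> e n = x.
    move=> x; have [[n _ <-]|nx] := pselect (range e x); first by exists n.
    by exists 0%N.
  apply: (noext (range e) (fun w => e (pickle [seq d x | x <- w]))).
  - by exists (e 0%N), 0%N.
  - by rewrite G0 setD0 => _ [n _ <-]; exact: eA.
  - by move=> w _; eexists.
  - rewrite G0 set0U => v w [_ Sv] [_ Sw] /einj => /(_ I I) /(pcan_inj pickleK).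
    by apply: map_inj_on Sv Sw => x y /dP {2}<- /dP {2}<- ->.
have [SA|AS] := card_le_total (field G) (A `\` field G).
  (* The new words are coded by [f] after [k] has sent both copies of the field
     into the field, and [j] moves the codes to the second copy. *)
  exfalso; have [j [jA jinj]] := inj_of_card_le a0 SA.
  have /choice[d dP] : forall x, exists y, (j @` field G) x ->
    field G y /\ j y = x.
    move=> x; have [[y Gy <-]|nx] := pselect ((j @` field G) x);
      first by exists y.
    by exists a0.
  have [x|x y|k [kS kinj]] :=
    @codes_extend _ f _ (field G `|` j @` field G) d fcodes.
  - by move=> [//|/dP[]].
  - move=> [//|jx] [//|jy] _ _ dxy.
    by have [_ <-] := dP _ jx; have [_ <-] := dP _ jy; rewrite dxy.
  - have [fS finj] := codes_words fcodes kS kinj.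
    apply: (noext (j @` field G) (fun w => j (f [seq k x | x <- w]))).
    + by exists (j s0), s0.
    + by move=> _ [x /jA Ax <-].
    + by move=> w /fS Sw; eexists; first exact: Sw.
    + by move=> v w Uv Uw /jinj => /(_ (fS _ Uv) (fS _ Uw)) /finj; exact.
have [i [iS iinj]] := inj_of_card_le s0 AS.
have [x Ax nSx|x y Ax Ay nSx nSy|k [kS kinj]] := @codes_extend _ f _ A i fcodes.
- exact: iS.
- exact: iinj.
- have [fS finj] := codes_words fcodes kS kinj.
  by apply: (card_le_of_inj (f :=
    fun w => f [seq k x | x <- w])) => [w /fS/GA|].
Qed.

(** * Metrizability by sequences of invariants *)

Definition agree (T : Type) (n : nat) (u v : nat -> T) :=
  forall i, (i < n)%N -> u i = v i.

Lemma agree_le (T : Type) m n (u v : nat -> T) :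
  (m <= n)%N -> agree n u v -> agree m u v.
Proof. by move=> mn uv i im; apply: uv; exact: leq_trans mn. Qed.

Lemma agree_trans (T : Type) n (u v w : nat -> T) :
  agree n u v -> agree n v w -> agree n u w.
Proof. by move=> uv vw i ni; rewrite uv // vw. Qed.

(** A copy of [S] carrying the ultrametric for which two points are close when
    the sequences attached to them by [p] have a long common prefix. *)
Definition prefix_space (R : realType) (S : choiceType) (T : Type)
  (p : S -> nat -> T) (pinj : injective p) : Type := S.

Section prefix_metric.
Variables (R : realType) (S : choiceType) (T : Type).
Variables (p : S -> nat -> T) (pinj : injective p).

Local Open Scope ring_scope.

Let prefix_distP (x y : S) : exists r : R,
  (x = y /\ r = 0) \/ exists n, [/\ agree n (p x) (p y), p x n <> p y n &
                                    r = n.+1%:R^-1].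
Proof.
have [->|xy] := pselect (x = y); first by exists 0; left.
have ex : exists n, `[< p x n <> p y n >].
  apply: contrapT => nex; apply/xy/pinj/funext => n.
  by apply: contrapT => pn; apply: nex; exists n; apply/asboolP.
case: (ex_minnP ex) => n /asboolP pn nmin.
exists n.+1%:R^-1; right; exists n; split => // i ni.
apply: contrapT => pi; suff : (n <= i)%N by rewrite leqNgt ni.
by apply: nmin; apply/asboolP.
Qed.

Definition prefix_dist x y := sval (cid (prefix_distP x y)).

Lemma prefix_dist_lt n x y :
  prefix_dist x y < n.+1%:R^-1 <-> agree n.+1 (p x) (p y).
Proof.
rewrite /prefix_dist; case: cid => r /= [[-> ->]|[m [mxy nm ->]]].
  by split => // _; rewrite invr_gt0 ltr0n.
rewrite ltf_pV2 ?posrE ?ltr0n// ltr_nat ltnS; split.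
  by move=> nm'; exact: agree_le mxy.
by move=> nxy; rewrite ltnNge; apply/negP => mn; apply: nm; exact: nxy.
Qed.

Lemma prefix_dist_ge0 x y : 0 <= prefix_dist x y.
Proof.
rewrite /prefix_dist; case: cid => r /= [[_ ->//]|[m [_ _ ->]]].
by rewrite invr_ge0 ler0n.
Qed.

Lemma prefix_distxx x : prefix_dist x x = 0.
Proof. by rewrite /prefix_dist; case: cid => r /= [[]|[m []]]. Qed.

Lemma prefix_dist_pos x y : prefix_dist x y = 0 -> x = y.
Proof.
rewrite /prefix_dist; case: cid => r /= [[]//|[m [_ _ ->]]] /eqP.
by rewrite invr_eq0 pnatr_eq0.
Qed.

Lemma prefix_dist_le x y (r : R) : 0 <= r ->
  (forall n, r < n.+1%:R^-1 -> p x n = p y n) -> prefix_dist x y <= r.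
Proof.
move=> r0 rxy; rewrite {1}/prefix_dist;
  case: cid => _ /= [[_ ->//]|[m [_ nm ->]]].
by rewrite leNgt; apply/negP => /rxy.
Qed.

Lemma prefix_distC x y : prefix_dist x y = prefix_dist y x.
Proof.
suff le u v : prefix_dist u v <= prefix_dist v u by apply/eqP;
  rewrite eq_le !le.
apply: prefix_dist_le => [|n /prefix_dist_lt/(_ n (ltnSn n))//].
exact: prefix_dist_ge0.
Qed.

Lemma prefix_dist_triangle y x z :
  prefix_dist x z <= prefix_dist x y + prefix_dist y z.
Proof.
apply: prefix_dist_le => [|n lt]; first by rewrite addr_ge0 ?prefix_dist_ge0.
have /prefix_dist_lt/(_ n (ltnSn n)) -> : prefix_dist x y < n.+1%:R^-1.
  by apply: le_lt_trans lt; rewrite lerDl prefix_dist_ge0.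
suff /prefix_dist_lt/(_ n (ltnSn n)) : prefix_dist y z < n.+1%:R^-1 by [].
by apply: le_lt_trans lt; rewrite lerDr prefix_dist_ge0.
Qed.

HB.instance Definition _ := Choice.on (prefix_space R pinj).
HB.instance Definition _ := @isMetric.Build R (prefix_space R pinj) prefix_dist
  prefix_distxx prefix_dist_pos prefix_distC prefix_dist_triangle.

Lemma nbhs_prefix_spaceP (x : prefix_space R pinj)
    (A : set (prefix_space R pinj)) :
  nbhs x A <-> exists n, forall y, agree n (p x) (p y) -> A y.
Proof.
split => [/nbhs_ballP[e /= e0 eA]|[n nA]].
  have [n ne] : exists n, n.+1%:R^-1 < e.
    by exists (Num.truncn e^-1); rewrite invf_plt ?posrE// truncnS_gt.
  exists n.+1 => y /prefix_dist_lt xy; apply: eA.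
  by rewrite ballEmdist /=; exact: lt_trans ne.
apply/nbhs_ballP; exists n.+1%:R^-1 => /=; first by rewrite invr_gt0 ltr0n.
by move=> y;
  rewrite ballEmdist /= => /prefix_dist_lt /(agree_le (leqnSn n)) /nA.
Qed.

End prefix_metric.

Lemma metrizable_of_prefixes (R : realType) (S : topologicalType) (T : Type)
    (p : S -> nat -> T) : injective p ->
  (forall (x : S) A,
     nbhs x A <-> exists n, forall y, agree n (p x) (p y) -> A y) ->
  metrizable_space R S.
Proof.
move=> pinj nbhsP; exists (prefix_space R pinj : metricType R), id, id;
  split => // x A.
  by move=> /nbhs_prefix_spaceP/nbhsP.
by move=> /nbhsP/(@nbhs_prefix_spaceP R _ _ _ pinj).
Qed.

(** * Dense Baire subspaces *)

Lemma dense_preimage_val (X : topologicalType) (D U : set X) :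
  dense D -> open U -> dense U -> dense (set_val @^-1` U : set (set_type D)).
Proof.
move=> dD oU dU O [x Ox] [V oV VO]; move: Ox; rewrite -VO /= => Vx.
have [y [[Vy Uy] Dy]] : V `&` U `&` D !=set0.
  by apply: dD; [apply: dU => //; exists (set_val x) | exact: openI].
by exists (SigSub (mem_set Dy)).
Qed.

Lemma baire_of_dense_subspace (X : topologicalType) (D : set X) :
  dense D -> baire_space (set_type D) -> baire_space X.
Proof.
move=> dD bD U oU O [x Ox] oO.
have bU : dense (\bigcap_n (set_val @^-1` U n : set (set_type D))).
  apply: bD => n; have [oUn dUn] := oU n; split; last exact: dense_preimage_val.
  by exists (U n).
have [y [Oy Dy]] : O `&` D !=set0 by apply: dD => //; exists x.
have [z [Oz Uz]] : (set_val @^-1` O : set (set_type D)) `&`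
    \bigcap_n (set_val @^-1` U n) !=set0.
  by apply: bU; [exists (SigSub (mem_set Dy)) | exists O].
by exists (set_val z).
Qed.

(** * Tame open sets *)

(** A member of [Q] lying inside an open set missed by a maximal disjoint
    subfamily could be added to that subfamily. *)
Lemma disjoint_subfamily (X : topologicalType) (I : Type) (L : I -> set X)
    (Q : set I) (W : set X) :
  (forall O, open O -> O !=set0 -> O `<=` W ->
     exists2 i, Q i & L i !=set0 /\ L i `<=` O) ->
  exists S, [/\ S `<=` Q, trivIset S L &
    forall O, open O -> O !=set0 -> O `<=` W ->
      exists2 i, S i & O `&` L i !=set0].
Proof.
move=> Qdense; have [S [SQ SL Smax]] := ex_maximal_disjoint_subcollection L Q.
exists S; split => // O oO O0 OW; apply: contrapT => nS.
have [i Qi [[x Lix] LiO]] := Qdense O oO O0 OW.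
have iS j : S j -> ~ (L i `&` L j !=set0).
  by move=> Sj [y [/LiO Oy Ljy]]; apply: nS; exists j => //; exists y.
apply: (Smax (i |` S)).
- split; first by move=> j; right.
  by move=> /(_ i (or_introl erefl)) /iS; apply; exists x.
- by move=> j [->|/SQ].
- move=> j k [->|Sj] [->|Sk] //; first by move=> /(iS _ Sk).
    by rewrite setIC => /(iS _ Sj).
  exact: SL.
Qed.

Section tame.
Variable X : topologicalType.
Implicit Types (V : nat -> set (set X)) (W O U : set X).

(** When [X] is Baire, the points of [W] lying in all the unions form a dense
    G-delta set, on which the families [V n] induce clopen partitions that form
    together a base. *)
Definition tame_by V W := [/\
  forall n U, V n U -> open U /\ U `<=` W,
  forall n, trivIset (V n) id,
  forall n O, open O -> O !=set0 -> O `<=` W ->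
    exists2 U, V n U & O `&` U !=set0 &
  forall x, (forall n, exists2 U, V n U & U x) ->
    forall O, nbhs x O -> exists n U, [/\ V n U, U x & U `<=` O]].

Definition tame W := exists V, tame_by V W.

Lemma tame_locally :
  (forall W, open W -> W !=set0 ->
    exists U, [/\ open U, U !=set0, U `<=` W & tame U]) ->
  tame setT.
Proof.
move=> H.
have [W oW W0 _|F [FQ Fdisj Fdense]] := @disjoint_subfamily X _ id
    [set U | open U /\ tame U] setT.
  by have [U [oU U0 UW tU]] := H _ oW W0; exists U.
have /choice[G GP] : forall U, exists V, F U -> tame_by V U.
  move=> U; have [/FQ[_ [V VP]]|nFU] := pselect (F U); first by exists V.
  by exists (fun=> set0).
exists (fun n => \bigcup_(U in F) G U n); split.
- by move=> n U [U0 /GP[/(_ n U) + _ _ _ GU]] => /(_ GU)[oU _]; split.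
- move=> n U U' [W FW GU] [W' FW' GU'] [x [Ux U'x]].
  have [/(_ _ _ GU)[_ UW] + _ _] := GP _ FW.
  have [/(_ _ _ GU')[_ UW'] _ _ _] := GP _ FW'.
  have WW' : W = W' by apply: Fdisj => //; exists x; split;
    [exact: UW | exact: UW'].
  by rewrite -WW' in GU'; move=> /(_ n U U' GU GU'); apply; exists x.
- move=> n O oO O0 _; have [W FW OW] := Fdense O oO O0 (@subsetT _ _).
  have [oW _] := FQ _ FW; have [_ _ Gdense _] := GP _ FW.
  have [U GU OU] := Gdense n _ (openI oO oW) OW (@subIsetr _ _ _).
  by exists U; [exists W | move: OU; apply: subset_nonempty; rewrite setIAC;
    exact: subIsetl].
- move=> x xG O Ox; have [U [W FW GU] Ux] := xG 0%N.
  have [+ _ _ +] := GP _ FW => GW /(_ x _ O Ox) [n|n [U' [GU' U'x U'O]]].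
    have [U' [W' FW' GU'] U'x] := xG n.
    suff -> : W = W' by exists U'.
    apply: Fdisj => //; exists x; split; first exact: (GW _ _ GU).2.
    by have [/(_ _ _ GU')[_ +] _ _ _] := GP _ FW'; apply.
  by exists n, U'; split => //; exists W.
Qed.

(** The dense metrizable Baire subspace is the set of points lying in all the
    unions; the sequence attached to such a point consists of the members of the
    successive families that contain it. *)
Lemma tame_dense_metrizable (R : realType) :
  hausdorff_space X -> baire_space X -> tame setT ->
  exists D : set X,
    [/\ dense D, metrizable_space R (set_type D) & baire_space (set_type D)].
Proof.
move=> hX bX [V [Vo Vdisj Vdense Vbase]].
pose E n := \bigcup_(U in V n) U.
have oE n : open (E n) by apply: bigcup_open => U /Vo[].
have dE n : dense (E n).
  move=> O O0 oO; have [U VU [x [Ox Ux]]] := Vdense n O oO O0 (@subsetT _ _).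
  by exists x; split => //; exists U.
pose D := \bigcap_n E n.
have dD : dense D by exact: bX.
exists D; split => //.
- have /choice[p pP] : forall x : set_type D, exists p : nat -> set X,
    forall n, V n (p n) /\ p n (set_val x).
    move=> x.
    have /choice[p pP] : forall n, exists U, V n U /\ U (set_val x);
      last by exists p.
    by move=> n; have [U VU Ux] := set_valP x n I; exists U.
  have pE n (x y : set_type D) : p x n (set_val y) -> p x n = p y n.
    move=> xy; apply: (Vdisj n); [exact: (pP x n).1|exact: (pP y n).1|].
    by exists (set_val y); split => //; exact: (pP y n).2.
  have pbase (x : set_type D) O : nbhs (set_val x) O -> exists n, p x n `<=` O.
    move=> Ox; have [n|n [U [VU Ux UO]]] := Vbase (set_val x) _ O Ox.
      by exists (p x n); [exact: (pP x n).1 | exact: (pP x n).2].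
    exists n; suff -> : p x n = U by [].
    apply: (Vdisj n) => //; first exact: (pP x n).1.
    by exists (set_val x); split => //; exact: (pP x n).2.
  apply: (@metrizable_of_prefixes R _ _ p).
    move=> x y pxy; apply/val_inj/hX => A B /pbase[n nA] By.
    exists (set_val y); split; last exact: nbhs_singleton By.
    by apply: nA; rewrite pxy; exact: (pP y n).2.
  move=> x A; split=> [[_ [ [ O oO <-] Ox OA]]|[n nA]].
    have [n nO] := pbase x O (open_nbhs_nbhs (conj oO Ox)).
    exists n.+1 => y xy; apply: OA; apply: nO; rewrite xy//; exact: (pP y n).2.
  suff : nbhs x [set y | agree n (p x) (p y)] by apply: filterS => y /nA.
  elim: n {nA} => [|n IH]; first by apply: filterS filterT => y _ i.
  suff xn : nbhs x [set y | p x n = p y n].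
    apply: filterS (filterI IH xn) => y [xy pn] i; rewrite ltnS leq_eqVlt.
    by case/predU1P => [->//|/xy].
  exists (set_val @^-1` p x n); split.
  + by exists (p x n) => //; have [] := Vo _ _ (pP x n).1.
  + exact: (pP x n).2.
  + by move=> y; exact: pE.
- move=> U UP.
  have /choice[ O OP] : forall n, exists O, open O /\ set_val @^-1` O = U n.
    by move=> n; have [ [ O oO OU] _] := UP n; exists O.
  have dO n : dense (O n).
    move=> W W0 oW; have [x [Wx Dx]] := dD W W0 oW.
    have [y [Wy Uy]] : (set_val @^-1` W : set (set_type D)) `&` U n !=set0.
      apply: (UP n).2; first by exists (SigSub (mem_set Dx)).
      by exists W.
    by exists (set_val y); split => //; move: Uy; rewrite -(OP n).2.
  have dOE : dense (\bigcap_n (O n `&` E n)).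
    apply: bX => n; split; first by apply: openI; [exact: (OP n).1|].
    by apply: denseI => //; exact: (OP n).1.
  move=> W' [y +] [W oW WE]; rewrite -WE /= => Wy.
  have [x [Wx OEx]] : W `&` \bigcap_n (O n `&` E n) !=set0.
    by apply: dOE => //; exists (set_val y).
  have Dx : D x by move=> n _; exact: (OEx n I).2.
  exists (SigSub (mem_set Dx)); split => // n _.
  by rewrite -(OP n).2; exact: (OEx n I).1.
Qed.

End tame.

(** * The tree of decreasing sequences of basic open sets *)

Section nodes.
Variables (X : topologicalType) (B : set (set X)) (W0 : set X).
Hypothesis Bbasis : basis B.

Lemma basis_nbhs x O : nbhs x O -> exists U, [/\ B U, U x & U `<=` O].
Proof. by move=> /(Bbasis.2 x)[U [BU Ux] UO]; exists U. Qed.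

Lemma basis_open O : open O -> O !=set0 ->
  exists U, [/\ B U, U !=set0 & U `<=` O].
Proof.
move=> oO [x Ox];
  have [U [BU Ux UO]] := basis_nbhs (open_nbhs_nbhs (conj oO Ox)).
by exists U; split => //; exists x.
Qed.

(** A pair [(z, n)] encodes the finite sequence [z 0, ..., z n].  One such
    sequence has many codes, which is harmless because pairs are compared only
    through their prefixes and their tips. *)
Definition node (s : (nat -> set X) * nat) := [/\
  forall i, (i <= s.2)%N -> B (s.1 i), s.1 s.2 !=set0, s.1 0%N `<=` W0 &
  forall i, (i < s.2)%N -> s.1 i.+1 `<=` s.1 i].

Definition tip (s : (nat -> set X) * nat) := s.1 s.2.

Definition ext (s t : (nat -> set X) * nat) :=
  [/\ (s.2 <= t.2)%N, agree s.2.+1 s.1 t.1 & node t].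

Definition graft (s : (nat -> set X) * nat) (U : set X) :
    (nat -> set X) * nat :=
  (fun i => if (i <= s.2)%N then s.1 i else U, s.2.+1).

Lemma tip_graft s U : tip (graft s U) = U.
Proof. by rewrite /tip /graft /= ltnn. Qed.

Lemma ext_graft s U : node s -> B U -> U !=set0 -> U `<=` tip s ->
  ext s (graft s U).
Proof.
move=> [Bs s0 sW sdec] BU U0 Us; split => //=; first by move=> i;
  rewrite ltnS => ->.
split => /=.
- by move=> i _; case: ifP => // /Bs.
- by rewrite ltnn.
- exact: sW.
- move=> i; rewrite ltnS => is2; rewrite is2; case: ifP => [/sdec //|].
  move=> /negbT; rewrite -leqNgt => si.
  by have -> : i = s.2 by apply/eqP; rewrite eqn_leq is2.
Qed.

Lemma node_decreasing s i j : node s -> (i <= j)%N -> (j <= s.2)%N ->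
  s.1 j `<=` s.1 i.
Proof.
move=> [_ _ _ sdec]; elim: j => [|j IH]; first by rewrite leqn0 => /eqP -> _ x.
rewrite leq_eqVlt => /predU1P[-> _ x //|ij] js.
by apply: subset_trans (IH ij (ltnW js)); exact: sdec.
Qed.

Lemma node_restrict s z n : node s -> (n <= s.2)%N -> agree n.+1 s.1 z ->
  node (z, n).
Proof.
move=> ns sn sz; have [Bs s0 sW sdec] := ns.
split => /=.
- by move=> i im; rewrite -sz //; apply: Bs; exact: leq_trans sn.
- by rewrite -sz //; apply: subset_nonempty s0; exact: node_decreasing.
- by rewrite -sz.
- by move=> i im; rewrite -!sz // ?ltnS 1?ltnW//; apply: sdec;
    exact: leq_trans sn.
Qed.

Lemma ext_refl s : node s -> ext s s.
Proof. by []. Qed.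

Lemma ext_trans s t u : ext s t -> ext t u -> ext s u.
Proof.
move=> [st ast _] [tu atu nu]; split => //; first exact: leq_trans tu.
by apply: agree_trans ast _; exact: agree_le atu.
Qed.

Lemma ext_tip s t : ext s t -> tip t `<=` tip s.
Proof. by move=> [st ast nt]; rewrite /tip ast//; exact: node_decreasing. Qed.

Definition local_base (z : nat -> set X) (x : X) :=
  (forall n, z n x) /\ forall O, nbhs x O -> exists n, z n `<=` O.

Definition bad (z : nat -> set X) := [/\
  forall n, node (z, n),
  exists x, forall n, z n x &
  ~ exists x, local_base z x].

(** The level [S k.+1] of the tree is a maximal set of nodes with disjoint tips
    among those that satisfy [D k] and properly extend a node of [S k].  A point
    in the tips of every level singles out one node per level, by disjointness,
    and these nodes form a branch [z]; unless the second alternative holds, [z]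
    is not bad, hence is a neighborhood base at the given point. *)
Lemma tree_dichotomy (D : nat -> set ((nat -> set X) * nat)) s0 :
  hausdorff_space X -> node s0 ->
  (forall k s, node s -> exists t, [/\ ext s t, (s.2 < t.2)%N & D k t]) ->
  tame (tip s0) \/
  exists y, [/\ bad y, agree s0.2.+1 s0.1 y &
    forall k, exists2 t, D k t & agree t.2.+1 t.1 y].
Proof.
move=> hX ns0 Ddense.
have [|nobad] := pselect (exists y, [/\ bad y, agree s0.2.+1 s0.1 y &
    forall k, exists2 t, D k t & agree t.2.+1 t.1 y]); [by right|left].
pose Inv (S : set ((nat -> set X) * nat)) := [/\
  forall t, S t -> ext s0 t, trivIset S tip &
  forall O, open O -> O !=set0 -> O `<=` tip s0 ->
    exists2 t, S t & O `&` tip t !=set0].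
pose refines k (S S' : set ((nat -> set X) * nat)) :=
  forall t, S' t -> D k t /\ exists s, [/\ S s, ext s t & (s.2 < t.2)%N].
have otip t : node t -> open (tip t) by move=> [Bt _ _ _]; apply/Bbasis.1/Bt.
have step k S : Inv S -> exists S', Inv S' /\ refines k S S'.
  move=> [Sext Sdisj Sdense].
  have [ O oO O0 Os0|S' [S'Q S'disj S'dense]] := @disjoint_subfamily X _ tip
    [set t | D k t /\ exists s, [/\ S s, ext s t & (s.2 < t.2)%N]] (tip s0).
    have [s Ss Os] := Sdense O oO O0 Os0; have [_ _ ns] := Sext s Ss.
    have [U [BU U0 UOs]] := basis_open (openI oO (otip _ ns)) Os.
    have sg : ext s (graft s U) by apply: ext_graft => // x /UOs[].
    have [_ _ ng] := sg; have [t [gt lt Dt]] := Ddense k _ ng.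
    have [_ _ nt] := gt.
    exists t; first split => //; first exists s; split => //.
    - exact: ext_trans gt.
    - by apply: leq_ltn_trans lt; exact: leqnSn.
    - by have [_ + _ _] := nt.
    - by move=> x /(ext_tip gt); rewrite tip_graft => /UOs[].
  exists S'; split; last by move=> t /S'Q.
  by split => // t /S'Q[_ [s [/Sext ss0 st _]]]; exact: ext_trans st.
have /choice[F FP] : forall kS, exists S', Inv kS.2 ->
  Inv S' /\ refines kS.1 kS.2 S'.
  move=> [k S]; have [/(step k)[S' S'P]|nS] := pselect (Inv S);
    first by exists S'.
  by exists S.
pose S := fix S n := if n is k.+1 then F (k, S k) else [set s0].
have SInv n : Inv (S n).
  elim: n => [|n IH] /=; last exact: (FP (n, S n) IH).1.
  split.
  - by move=> _ ->; exact: ext_refl.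
  - by move=> _ _ -> -> _.
  - by move=> O _ [x Ox] Os0; exists s0 => //; exists x; split => //;
      exact: Os0.
have Sref n : refines n (S n) (S n.+1) by exact: (FP (n, S n) (SInv n)).2.
exists (fun n => tip @` S n); split.
- move=> n _ [t St <-]; have [/(_ _ St) st _ _] := SInv n.
  by split; [have [_ _ /otip] := st | exact: ext_tip].
- move=> n _ _ [s Ss <-] [t St <-] st; have [_ Sdisj _] := SInv n.
  by rewrite (Sdisj s t).
- move=> n O oO O0 Os0; have [_ _ Sdense] := SInv n.
  by have [t St Ot] := Sdense O oO O0 Os0; exists (tip t) => //; exists t.
move=> x xS O Ox.
have /choice[t tP] : forall n, exists t, S n t /\ tip t x.
  by move=> n; have [_ [t St <-] tx] := xS n; exists t.
have tS n : S n (t n) := (tP n).1.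
have tx n : tip (t n) x := (tP n).2.
have nt n : node (t n) by have [/(_ _ (tS n))[]] := SInv n.
have tstep n : ext (t n) (t n.+1) /\ ((t n).2 < (t n.+1).2)%N.
  have [_ [s [Ss st lt]]] := Sref n _ (tS n.+1).
  suff <- : s = t n by [].
  have [_ Sdisj _] := SInv n; apply: (Sdisj) => //.
  by exists x; split; [apply: (ext_tip st); exact: tx | exact: tx].
have tle m n : (m <= n)%N -> ext (t m) (t n).
  elim: n => [|n IH]; first by rewrite leqn0 => /eqP ->; exact: ext_refl.
  rewrite leq_eqVlt => /predU1P[->|/IH mn]; first exact: ext_refl.
  exact: ext_trans (tstep n).1.
have nle n : (n <= (t n).2)%N.
  by elim: n => // n IH; apply: leq_ltn_trans IH (tstep n).2.
pose z n := (t n).1 n.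
have tz n : agree (t n).2.+1 (t n).1 z.
  move=> i ni; rewrite /z; have [in_|ni'] := leqP i n.
    have [_ a _] := tle _ _ in_; apply/esym/a; rewrite ltnS; exact: nle.
  by have [_ a _] := tle _ _ (ltnW ni'); exact: a.
have zx n : z n x by apply: (node_decreasing (nt n) (nle n) (leqnn _));
  exact: tx.
have [y [zy ybase]] : exists y, local_base z y.
  apply: contrapT => nbase; apply: nobad; exists z; split.
  - split => //; last by exists x.
    move=> n; apply: (node_restrict (nt n) (nle n)).
    by apply: agree_le (tz n); rewrite ltnS.
  - by have [/(_ _ (tS 0%N))[s0t a _] _ _] := SInv 0%N; apply: agree_trans a _;
      apply: agree_le (tz 0%N).
  - by move=> k; exists (t k.+1) => //; have [] := Sref k _ (tS k.+1).
have yx : y = x.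
  apply/hX => A C /ybase[n nA] Cx; exists x; split; last exact: nbhs_singleton.
  exact/nA/zx.
have [n nO] : exists n, z n `<=` O by apply: ybase; rewrite yx.
exists n, (tip (t n)); split => //; first by exists (t n).
by apply: subset_trans nO; exact: node_decreasing.
Qed.

End nodes.

(** * The space of bad sequences *)

Lemma open_prefix_cylinder (R : realType) (S : choiceType) (T : Type)
    (p : S -> nat -> T) (pinj : injective p) n (u : nat -> T) :
  open [set y : prefix_space R pinj | agree n u (p y)].
Proof.
rewrite openE => y uy; apply/nbhs_prefix_spaceP; exists n => z yz.
exact: agree_trans yz.
Qed.

Section bad_space.
Variables (R : realType) (X : topologicalType) (B : set (set X)) (W0 : set X).
Hypothesis hX : hausdorff_space X.
Hypothesis rX : regular_space X.
Hypothesis Bbasis : basis B.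
Hypothesis oW0 : open W0.
Hypothesis W00 : W0 !=set0.
(* Under this hypothesis bad sequences are generic: the first alternative of
   [tree_dichotomy] is excluded. *)
Hypothesis wild : forall U, open U -> U !=set0 -> U `<=` W0 -> ~ tame U.

Let badX := bad B W0.
Let val_bad (z : set_type badX) : nat -> set X := set_val z.
Let val_bad_inj : injective val_bad.
Proof. exact: val_inj. Qed.
Let Z : topologicalType := prefix_space R val_bad_inj.

Let badP (z : Z) : bad B W0 (val_bad z).
Proof. exact: set_valP. Qed.

Let node_bad (z : Z) n : node B W0 (val_bad z, n).
Proof. by have [+ _ _] := badP z; exact. Qed.

Let bad_through (D : nat -> set ((nat -> set X) * nat)) s0 : node B W0 s0 ->
  (forall k s, node B W0 s ->
     exists t, [/\ ext B W0 s t, (s.2 < t.2)%N & D k t]) ->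
  exists z : Z, agree s0.2.+1 s0.1 (val_bad z) /\
    forall k, exists2 t, D k t & agree t.2.+1 t.1 (val_bad z).
Proof.
move=> ns0 Dd; have [Bs0 s00 _ _] := ns0.
have [s0tame|[y [ybad sy yD]]] := tree_dichotomy Bbasis hX ns0 Dd.
  case: (@wild (tip s0)) => //; first by apply: Bbasis.1; exact: Bs0.
  have [_ _ sW _] := ns0; apply: subset_trans sW.
  exact: (node_decreasing ns0).
by exists (SigSub (mem_set ybad)).
Qed.

Let strict_ext s : node B W0 s -> exists t, ext B W0 s t /\ (s.2 < t.2)%N.
Proof.
move=> ns; have [Bs s0 _ _] := ns; exists (graft s (tip s)).
by split => //; apply: ext_graft => //; exact: Bs.
Qed.

Let bad_meets s : node B W0 s -> exists z : Z, agree s.2.+1 s.1 (val_bad z).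
Proof.
move=> ns; have [|z [sz _]] := @bad_through (fun=> setT) s ns; last by exists z.
by move=> _ t /strict_ext[u [tu lt]]; exists u.
Qed.

Let bad_inhabited : exists z : Z, True.
Proof.
have [U [BU U0 UW]] := basis_open Bbasis oW0 W00.
by have [|z _] := @bad_meets (fun=> U, 0%N); [split|exists z].
Qed.

(** A dense open set becomes a condition on nodes: that all bad sequences
    through the node belong to it. *)
Lemma baire_bad : baire_space Z.
Proof.
move=> U UP O [x Ox] oO.
have /nbhs_prefix_spaceP[n nO] : nbhs x O by apply: open_nbhs_nbhs.
pose D k := [set t | forall z : Z, agree t.2.+1 t.1 (val_bad z) -> U k z].
have [k s ns|z [xz zD]] := @bad_through D (val_bad x, n) (node_bad x n).
  have [oU dU] := UP k; have [y0 sy0] := bad_meets ns.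
  have [y [sy Uy]] : [set y : Z | agree s.2.+1 s.1 (val_bad y)] `&` U k !=set0.
    by apply: dU; [exists y0 | exact: open_prefix_cylinder].
  have /nbhs_prefix_spaceP[m mU] : nbhs y (U k) by apply: open_nbhs_nbhs.
  exists (val_bad y, maxn s.2.+1 m); split => /=.
  - by split => //=; rewrite leq_max leqnSn.
  - by rewrite leq_max leqnn.
  - by move=> z yz; apply: mU; apply: agree_le yz; rewrite leqW// leq_maxr.
exists z; split; first by apply: nO; apply: agree_le xz.
by move=> k _; have [t Dt tz] := zD k; exact: Dt.
Qed.

(** Choosing a bad sequence with each possible prefix gives a dense set. *)
Lemma density_bad : realizes_weight B -> infinite_set B ->
  density_le_weight Z X.
Proof.
move=> Bw Binf; have [z0 _] := bad_inhabited.
have /choice[c cP] : forall w, exists z : Z,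
    (exists z' n, mkseq (val_bad z') n = w) ->
      exists n, mkseq (val_bad z) n = w.
  move=> w;
    have [[z [n zw]]|nz] := pselect (exists z' n, mkseq (val_bad z') n = w).
    by exists z => _; exists n.
  by exists z0.
have cdense : dense (c @` words B : set Z).
  move=> O [x Ox] oO;
    have /nbhs_prefix_spaceP[n nO] : nbhs x O by apply: open_nbhs_nbhs.
  pose w := mkseq (val_bad x) n.+1.
  have [m mw] := cP w (ex_intro _ x (ex_intro _ n.+1 erefl)).
  exists (c w); split; last first.
    exists w => //; split => // U /mapP[i _ ->].
    by have [+ _ _ _] := node_bad x i; apply => /=.
  have mn : m = n.+1 by have := congr1 size mw; rewrite !size_mkseq.
  apply: nO => i ni; have := congr1 (fun w => nth set0 w i) mw.
  by rewrite mn !nth_mkseq ?(ltnW ni)//; rewrite ltnS ltnW.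
have [D [dD Dmin]] := smallest_card_exists (ex_intro _ _ cdense).
exists D, B; split => //; apply: (card_le_trans (Dmin _ cdense)).
by apply: (card_le_trans (card_image_le _ _)); exact: card_words_le.
Qed.

Lemma metrizable_bad : metrizable_space R Z.
Proof.
by apply: (@metrizable_of_prefixes R Z _ val_bad val_bad_inj) => x A;
  exact: nbhs_prefix_spaceP.
Qed.

(** Regularity of [X] is used for the second part: it provides a neighborhood
    [A] of [f z] with small closure, and a term of [z] lies in that closure
    because every open set meeting this term contains a value of [f] that also
    lies in [A]. *)
Lemma bad_selection : exists2 f : Z -> X, quasicontinuous f &
  forall z : Z, ~ {for z, continuous f}.
Proof.
have /choice[f fP] : forall z : Z, exists x, forall n, val_bad z n x.
  by move=> z; have [_ + _] := badP z.
(* Continuing a prefix of [z] by a basic subset [U] of [O] forces the values of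
   [f] into [O], since [f y] belongs to all the terms of [y]. *)
have fcyl (z : Z) n O : open O -> O `&` val_bad z n !=set0 ->
    exists t, [/\ node B W0 t, (n < t.2)%N, agree n.+1 (val_bad z) t.1 &
      forall y : Z, agree t.2.+1 t.1 (val_bad y) -> (O `&` val_bad z n) (f y)].
  move=> oO Oz; have ozn : open (val_bad z n).
    by have [/(_ n (leqnn n))/Bbasis.1] := node_bad z n.
  have [U [BU U0 UO]] := basis_open Bbasis (openI oO ozn) Oz.
  have [le ag nt] : ext B W0 (val_bad z, n) (graft (val_bad z, n) U).
    by apply: ext_graft => // x /UO[].
  exists (graft (val_bad z, n) U); split => //= y ty; apply: UO.
  by have := fP y n.+1; rewrite -ty //= ltnn.
exists f.
- move=> z Oz Ofz /nbhs_prefix_spaceP[n nOz];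
    rewrite nbhsE => -[ O [oO Ofz'] OOfz].
  have [|t [nt lt zt tO]] := fcyl z n O oO; first by exists (f z).
  exists [set y : Z | agree t.2.+1 t.1 (val_bad y)]; split.
  + exact: open_prefix_cylinder.
  + exact: bad_meets.
  + move=> y ty; apply: nOz; apply: agree_trans (agree_le (leqnSn n) zt) _.
    by apply: agree_le ty; rewrite leqW// ltnW.
  + by move=> _ [y /tO[Ofy _] <-]; exact: OOfz.
- move=> z fz; have [_ _] := badP z; apply; exists (f z); split => // O Oz.
  have [A Az AO] := rX Oz.
  have /nbhs_prefix_spaceP[n nA] := fz _ Az.
  exists n => x zx; apply: AO => C; rewrite nbhsE => -[C' [oC' C'x] C'C].
  have [|t [nt lt zt tC]] := fcyl z n C' oC'; first by exists x.
  have [y ty] := bad_meets nt.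
  exists (f y); split; last by apply: C'C; exact: (tC y ty).1.
  apply: nA; apply: agree_trans (agree_le (leqnSn n) zt) _.
  by apply: agree_le ty; rewrite leqW// ltnW.
Qed.

Lemma not_piotrowski : realizes_weight B -> infinite_set B ->
  ~ piotrowski_space (baire_metrizable_density_le_weight R X) X.
Proof.
move=> Bw Binf pX; have [f fq nf] := bad_selection.
have CZ : baire_metrizable_density_le_weight R X Z.
  by split; [exact: baire_bad | exact: metrizable_bad | exact: density_bad].
have Z0 : [set: Z] !=set0 by have [z _] := bad_inhabited; exists z.
by have [z /nf] := pX Z CZ Z0 f fq.
Qed.
End bad_space.

(** * Isolated points *)

Lemma tame_isolated (X : topologicalType) (x : X) : open [set x] ->
  tame [set x].
Proof.
move=> ox; exists (fun=> [set [set x]]); split.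
- by move=> _ _ ->; split.
- by move=> _ _ _ -> ->.
- by move=> _ O oO [y Oy] Ox; exists [set x] => //; exists y; split => //;
    exact: Ox.
- move=> _ /(_ 0%N)[_ -> ->] O Ox; exists 0%N, [set x]; split => // _ ->.
  exact: nbhs_singleton.
Qed.

Lemma finite_basis_isolated (X : topologicalType) (B : set (set X)) :
  hausdorff_space X -> basis B -> finite_set B -> forall x : X, open [set x].
Proof.
move=> hX Bbasis Bfin x.
have /finite_fsetP[F FE] : finite_set [set U | B U /\ U x].
  by apply: sub_finite_set Bfin => U [].
suff: nbhs x [set x] by rewrite openE => xx _ ->.
have : nbhs x (\bigcap_(U in [set U | B U /\ U x]) U).
  rewrite FE; apply: filter_bigI => U UF.
  have [BU Ux] : [set U | B U /\ U x] U by rewrite FE.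
  by apply: open_nbhs_nbhs; split => //; exact: Bbasis.1.
apply: filterS => y yF;
  apply/esym/hX => A C /(basis_nbhs Bbasis)[U [BU Ux UA]] Cy.
exists y; split; last exact: nbhs_singleton.
by apply: UA; exact: yF.
Qed.

Theorem theorem7p2 (R : realType) (X : topologicalType) :
  tychonoff_space X ->
  piotrowski_space (baire_metrizable_density_le_weight R X) X ->
  (exists D : set X,
     [/\ dense D, metrizable_space R (set_type D) & baire_space (set_type D)])
  <-> baire_space X.
Proof.
move=> [hX /(@completely_regular_regular R) rX] pX; split.
  by move=> [D [dD _ bD]]; exact: baire_of_dense_subspace bD.
move=> bX; apply: tame_dense_metrizable => //; apply: tame_locally => W oW W0.
have [B Bw] : exists B, @realizes_weight X B.
  apply: smallest_card_exists; exists open; split => // x O.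
  by rewrite nbhsE => -[U [oU Ux] UO]; exists U.
have Bbasis : basis B by case: Bw.
apply: contrapT => nW; have [Bfin|Binf] := pselect (finite_set B).
  apply: nW; have [x Wx] := W0; exists [set x].
  have ox := finite_basis_isolated hX Bbasis Bfin x.
  by split; [|exists x|move=> _ ->|exact: tame_isolated].
apply: (not_piotrowski hX rX Bbasis oW W0 _ Bw Binf pX) => U oU U0 UW tU.
by apply: nW; exists U.
Qed.
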